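(* (a) If $k$ is an odd positive integer and $n$ is a positive integer such that $n$ is not divisible by any prime $p$ with $p\mid D_{k-1}$, then $n^2$ divides $2S_k(n)$. (b) Conversely, if $k$ is an odd positive integer and $n$ is a positive integer relatively prime to $k$ such that $n^2$ divides $2S_k(n)$, then $n$ is not divisible by any prime $p$ such that $p\mid D_{k-1}$.
   Context: For integers $k\ge 1$ and $n\ge 1$, $S_k(n):=\sum_{i=1}^{n-1} i^k$ (empty sum $=0$ for $n=1$). The Bernoulli numbers $B_i$ are defined by $\sum_{i=0}^\infty B_i\frac{x^i}{i!}=\frac{x}{e^x-1}$. $D_{k-1}$ denotes the denominator of the $(k-1)$th Bernoulli number $B_{k-1}$.
   Formalization: Part (a) is stated only for odd k other than 1: at k = 1 it is false, since D_0 = 1 makes the condition on n void while 2S_1(n) = n(n-1) is divisible by n^2 only for n = 1 (e.g. n = 2 fails). *)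

(* Defs.v *)
From mathcomp Require Import all_boot all_order all_algebra.

Set Implicit Arguments.
Unset Strict Implicit.
Unset Printing Implicit Defensive.

Import GRing.Theory.
Local Open Scope ring_scope.

Definition power_sum (k n : nat) : nat := (\sum_(1 <= i < n) i ^ k)%N.

(* A formal power series over the rationals is the sequence of its
   coefficients. *)
Definition fps := nat -> rat.

Definition fps_mul (f g : fps) : fps :=
  fun n => \sum_(i < n.+1) f i * g (n - i)%N.

Definition fps_sub (f g : fps) : fps := fun n => f n - g n.

Definition fps_one : fps := fun n => (n == 0%N)%:R.

Definition fps_X : fps := fun n => (n == 1%N)%:R.

Definition egf (B : nat -> rat) : fps := fun n => B n / n`!%:R.

Definition fps_exp : fps := egf (fun=> 1).

(* egf B = X / (exp X - 1); the series exp X - 1 is not invertible, so the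
   quotient is expressed by cross-multiplication, which determines B by
   [is_bernoulli_unique]. *)
Definition is_bernoulli (B : nat -> rat) : Prop :=
  fps_mul (egf B) (fps_sub fps_exp fps_one) =1 fps_X.

Lemma fps_expB1_0 : fps_sub fps_exp fps_one 0 = 0.
Proof. by rewrite /fps_sub /fps_exp /egf /fps_one fact0 divr1 subrr. Qed.

Lemma fps_expB1_S n : fps_sub fps_exp fps_one n.+1 = n.+1`!%:R^-1.
Proof. by rewrite /fps_sub /fps_exp /egf /fps_one div1r subr0. Qed.

Lemma fps_mul_expB1_S f n :
  fps_mul f (fps_sub fps_exp fps_one) n.+1 =
    \sum_(i < n) f i / (n - i).+1`!%:R + f n.
Proof.
rewrite /fps_mul !big_ord_recr /= subnn fps_expB1_0 mulr0 addr0.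
rewrite subSnn fps_expB1_S invr1 mulr1; congr (_ + _).
by apply: eq_bigr => i _; rewrite subSn 1?ltnW // fps_expB1_S.
Qed.

Lemma fact_neq0 n : n`!%:R != 0 :> rat.
Proof. by rewrite Num.Theory.pnatr_eq0 -lt0n fact_gt0. Qed.

Lemma is_bernoulli_unique (B C : nat -> rat) :
  is_bernoulli B -> is_bernoulli C -> B =1 C.
Proof.
move=> hB hC n; elim/ltn_ind: n => n IH.
have := etrans (hB n.+1) (esym (hC n.+1)).
rewrite !fps_mul_expB1_S (eq_bigr (fun i : 'I_n => egf C i / (n - i).+1`!%:R)).
  by move/addrI/mulIf; apply; rewrite invr_eq0 fact_neq0.
by move=> i _; rewrite /egf IH.
Qed.

Lemma bernoulli_sig : {B : nat -> rat | is_bernoulli B}.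
Proof.
pose step (s : seq rat) : rat := (size s == 0)%N%:R
  - \sum_(i < size s) s`_i / (size s - i).+1`!%:R.
pose s n := iter n (fun t => rcons t (step t)) [::].
have sz n : size (s n) = n by elim: n => //= n IH; rewrite size_rcons IH.
have sE n i : (i < n)%N -> (s n)`_i = step (s i).
  elim: n => // n IH; rewrite ltnS leq_eqVlt => /orP[/eqP->|lt_in] /=.
    by rewrite nth_rcons sz ltnn eqxx.
  by rewrite nth_rcons sz lt_in IH.
exists (fun n => step (s n) * n`!%:R) => -[|n].
  by rewrite /fps_mul big_ord_recr big_ord0 /= fps_expB1_0 mulr0 addr0.
rewrite fps_mul_expB1_S /egf mulfK ?fact_neq0 // {2}/step sz.
rewrite (eq_bigr (fun i : 'I_n => (s n)`_i / (n - i).+1`!%:R)).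
  by rewrite addrC subrK /fps_X eqSS.
by move=> i _; rewrite mulfK ?fact_neq0 // sE.
Qed.

Definition bernoulli : nat -> rat := sval bernoulli_sig.

Lemma bernoulliP : is_bernoulli bernoulli.
Proof. exact: svalP. Qed.

Definition bernoulli_den (m : nat) : nat := `|denq (bernoulli m)|%N.

(* The degenerate case k = 1: since D_0 = 1, no prime divides D_0, and yet
   n ^ 2 need not divide 2 * S_1(n) = n * (n - 1). *)
Lemma bernoulli_den0 : bernoulli_den 0 = 1%N.
Proof.
have := bernoulliP 1%N.
rewrite fps_mul_expB1_S big_ord0 add0r /egf fact0 divr1 /fps_X => B0.
by rewrite /bernoulli_den B0.
Qed.

Lemma power_sum_1_2 : ~~ (2 ^ 2 %| 2 * power_sum 1 2)%N.
Proof. by rewrite /power_sum big_nat1. Qed.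

(* Main.v *)
Require Import Defs.
From mathcomp Require Import all_boot all_order all_algebra.
From mathcomp Require Import ring zify.

(** Write [T m n] for the sum of the [i ^ m] over [0 <= i < n], which is
    [powsum m n] below.  Let [k > 1] be odd and [m = k - 1], an even number.

    Pairing [i] with [n - i] in [2 * S_k(n)] and expanding modulo [n ^ 2] gives
    [i ^ k + (n - i) ^ k = k * i ^ m * n], because [k] is odd.  Hence [n ^ 2]
    divides [2 * S_k(n)] iff [n] divides [k * T m n] ([power_sum_double]).

    Whether [n] divides [T m n] is decided by the primes dividing [n]: it does
    iff every prime [p] dividing [n] divides [T m p] ([dvdn_powsum]).  This is
    proved by removing one prime factor of [n] at a time, cutting the interval
    [0, c * n) into [c] translates of [0, n) ([powsum_mul]).

    Finally, for even [m], a prime [p] divides the denominator of the Bernoulli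
    number [B_m] iff it does not divide [T m p] ([dvd_bernoulli_den]).  The
    reason is the one behind the von Staudt-Clausen theorem: Faulhaber's
    formula writes [T m p / p - B_m] as a combination of the [p * B_i], [i < m],
    all of which are integral at [p], with coefficients integral at [p].

    Together: in (a) every prime dividing [n] divides [T m p], so [n] divides
    [T m n]; in (b) [n] is prime to [k], so [n] divides [T m n], and every
    prime [p] dividing [n] divides [T m p], hence not the denominator of
    [B_m].  When [k = 1], that denominator is [1]. *)

(** Starting the sum at [0] (with [0 ^ 0 = 1]) makes Faulhaber's formula and
    the splitting of [powsum_mul] hold for all exponents, including [m = 0]. *)
Definition powsum (m n : nat) : nat := \sum_(i < n) i ^ m.

(** * Faulhaber's formula *)

Section Faulhaber.
Import GRing.Theory Num.Theory.
Local Open Scope ring_scope.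

Lemma bernoulli_rec (n : nat) :
  \sum_(i < n.+1) egf bernoulli i / (n - i).+1`!%:R = (n == 0%N)%:R.
Proof.
have := bernoulliP n.+1; rewrite fps_mul_expB1_S /fps_X eqSS => <-.
by rewrite big_ord_recr /= subnn divr1.
Qed.

(** The Bernoulli polynomial of degree [m + 1] without its constant term,
    divided by [(m + 1)!]. *)
Definition faulhaber (m : nat) (x : rat) : rat :=
  \sum_(i < m.+1) egf bernoulli i * (x ^+ (m.+1 - i) / (m.+1 - i)`!%:R).

Lemma expr_fact_diff (d : nat) (x : rat) :
  (x + 1) ^+ d / d`!%:R - x ^+ d / d`!%:R =
  \sum_(l < d) x ^+ l / l`!%:R / (d - l)`!%:R.
Proof.
rewrite [x + 1]addrC exprDn big_ord_recr /= subnn expr0 mul1r binn.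
rewrite mulr1n mulrDl addrK mulr_suml; apply: eq_bigr => l _.
rewrite expr1n mul1r -mulr_natr -(bin_fact (ltnW (ltn_ord l))) !natrM.
have := fact_neq0 l; have := fact_neq0 (d - l).
have : 'C(d, l)%:R != 0 :> rat by rewrite pnatr_eq0 -lt0n bin_gt0 ltnW.
move=> h1 h2 h3; field.
by rewrite h1 h2 h3.
Qed.

(** Expanding the difference gives a double sum over [i + l <= m] in which the
    coefficient of [x ^ l / l!] is the left-hand side of the Bernoulli
    recurrence of order [m - l]; so only [l = m] survives. *)
Lemma faulhaber_diff (m : nat) (x : rat) :
  faulhaber m (x + 1) - faulhaber m x = x ^+ m / m`!%:R.
Proof.
pose F (i l : nat) : rat :=
  egf bernoulli i * (x ^+ l / l`!%:R / (m - l - i).+1`!%:R).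
transitivity (\sum_(i < m.+1) \sum_(l < m.+1 | (i + l <= m)%N) F i l).
  rewrite /faulhaber -sumrB; apply: eq_bigr => i _.
  rewrite -mulrBr expr_fact_diff mulr_sumr.
  rewrite (big_ord_widen m.+1 (fun l => egf bernoulli i *
    (x ^+ l / l`!%:R / (m.+1 - i - l)`!%:R)) (leq_subr _ _)).
  apply: eq_big => [l|l lt_l]; first by have := ltn_ord i; lia.
  rewrite /F; congr (_ * (_ / _`!%:R)); lia.
rewrite (exchange_big_dep predT) //=.
rewrite (bigD1 ord_max) //= [X in _ + X]big1 ?addr0 => [|l l_neq].
  rewrite (bigD1 ord0) ?add0n //= big1 => [|i /andP[ilem i0]]; last first.
    by move: i0; rewrite -val_eqE /=; lia.
  rewrite addr0 /F !subnn divr1 /= -[RHS]mul1r; congr (_ * _).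
  (* What remains is B_0 = 1, the recurrence of order 0. *)
  have := bernoulli_rec 0.
  by rewrite big_ord_recr big_ord0 /= add0r divr1.
have lt_lm : (l < m)%N by move: l_neq (ltn_ord l); rewrite -val_eqE /=; lia.
have le_m : ((m - l).+1 <= m.+1)%N by lia.
transitivity (x ^+ l / l`!%:R *
    \sum_(i < (m - l).+1) egf bernoulli i / (m - l - i).+1`!%:R).
  rewrite (big_ord_widen m.+1
    (fun i => egf bernoulli i / (m - l - i).+1`!%:R) le_m).
  rewrite mulr_sumr; apply: eq_big => [i|i _]; first by lia.
  by rewrite /F mulrCA.
by rewrite bernoulli_rec subn_eq0 leqNgt lt_lm mulr0.
Qed.

Lemma faulhaber_powsum (m n : nat) :
  (powsum m n)%:R = m`!%:R * faulhaber m n%:R.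
Proof.
elim: n => [|n IH].
  rewrite /powsum big_ord0 /faulhaber big1 ?mulr0 // => i _.
  by rewrite subSn -1?ltnS // expr0n mul0r mulr0.
rewrite /powsum big_ord_recr natrD /= -/(powsum m n) IH.
have := faulhaber_diff m n%:R; rewrite natrX -natr1.
move/(canRL (subrK _)) ->.
by rewrite mulrDr mulrCA divff ?fact_neq0 // mulr1 addrC.
Qed.

Lemma powsum_bernoulli (m n : nat) :
  (powsum m n)%:R = \sum_(i < m.+1)
    'C(m, i)%:R * bernoulli i * (n%:R ^+ (m - i).+1 / (m - i).+1%:R).
Proof.
rewrite faulhaber_powsum mulr_sumr; apply: eq_bigr => i _.
have le_im : (i <= m)%N by rewrite -ltnS.
rewrite subSn // factS -(bin_fact le_im) !natrM /egf.
have := fact_neq0 i; have := fact_neq0 (m - i).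
have h : (m - i).+1%:R != 0 :> rat by rewrite pnatr_eq0.
move=> h1 h2; field.
by rewrite h1 h2 nat1r h.
Qed.

End Faulhaber.

(** * Rational numbers integral at a prime *)

(** Membership in the localization of the integers at [p].  Any denominator
    prime to [p] may serve, rather than the reduced one, so that stability
    under ring operations needs no gcd. *)
Definition pintegral (p : nat) (x : rat) : Prop :=
  exists2 d : nat, ~~ (p %| d) & (x * d%:R)%R \is a Num.int.

Section AtPrime.
Import GRing.Theory Num.Theory.
Local Open Scope ring_scope.

Variable p : nat.
Hypothesis p_pr : prime p.

Let p_neq0 : p%:R != 0 :> rat.
Proof. by rewrite pnatr_eq0 -lt0n prime_gt0. Qed.

Lemma pintegral_int (x : rat) : x \is a Num.int -> pintegral p x.
Proof.
by exists 1%N; rewrite ?mulr1 // dvdn1; case: eqP p_pr => // ->.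
Qed.

Lemma pintegral_nat (n : nat) : pintegral p n%:R.
Proof. by apply: pintegral_int; rewrite rpred_nat. Qed.

Lemma pintegralM (x y : rat) :
  pintegral p x -> pintegral p y -> pintegral p (x * y).
Proof.
move=> [d pd xd] [e pe ye]; exists (d * e)%N.
  by rewrite Euclid_dvdM // negb_or pd.
by rewrite natrM mulrACA rpredM.
Qed.

Lemma pintegralB (x y : rat) :
  pintegral p x -> pintegral p y -> pintegral p (x - y).
Proof.
move=> [d pd xd] [e pe ye]; exists (d * e)%N.
  by rewrite Euclid_dvdM // negb_or pd.
rewrite natrM mulrBl mulrA [d%:R * _]mulrC [y * _]mulrA.
by rewrite rpredB // rpredM // rpred_nat.
Qed.

Lemma pintegral_sum (I : finType) (F : I -> rat) :
  (forall i, pintegral p (F i)) -> pintegral p (\sum_i F i).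
Proof.
move=> hF; apply: big_ind => //; first exact: pintegral_nat 0.
move=> x y hx hy; rewrite -[y]opprK; apply: pintegralB => //.
by rewrite -[- y]add0r; apply: pintegralB => //; apply: pintegral_nat 0.
Qed.

Lemma pintegral_denq (x : rat) : pintegral p x <-> ~~ (p %| `|denq x|)%N.
Proof.
split=> [[d pd /intrP[a xd]]|pd]; last first.
  exists `|denq x|%N => //.
  rewrite -[x in x * _]divq_num_den pmulrn absz_denq.
  by rewrite mulfVK ?intr_eq0 ?denq_neq0.
apply: contra pd => /dvdn_trans; apply.
have num_eq : numq x * d%:Z = a * denq x.
  apply: (@intr_inj rat); rewrite !rmorphM /= -xd numqE -pmulrn; ring.
rewrite -(@Gauss_dvdr _ `|numq x|) 1?coprime_sym ?coprime_num_den //.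
by rewrite -[d]/(`|d%:Z|%N) -abszM num_eq abszM dvdn_mull.
Qed.

Lemma pintegral_dvd (n : nat) : pintegral p (n%:R / p%:R) <-> (p %| n)%N.
Proof.
split=> [[d pd /intrP[a nd]]|/dvdnP[q ->]]; last first.
  by rewrite natrM mulfK //; apply: pintegral_nat.
suff: (p %| n * d)%N by rewrite Euclid_dvdM // (negPf pd) orbF.
have e : (n * d)%:Z = a * p%:Z.
  apply: (@intr_inj rat); rewrite !rmorphM /= -nd -!pmulrn; field.
  exact: p_neq0.
by rewrite -[(n * d)%N]/(`|(n * d)%:Z|%N) e abszM dvdn_mull.
Qed.

Lemma pintegral_expr_div (v c : nat) :
  (0 < c)%N -> (logn p c <= v)%N -> pintegral p (p%:R ^+ v / c%:R).
Proof.
move=> c_gt0 le_cv; have [d pd def_c] := pfactor_coprime p_pr c_gt0.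
exists d; first by rewrite -prime_coprime.
have d0 : d%:R != 0 :> rat.
  by rewrite pnatr_eq0; apply: contraTneq c_gt0 => d0; rewrite def_c d0.
rewrite def_c natrM natrX -(subnK le_cv) exprD.
rewrite (_ : _ / _ * _ = (p ^ (v - logn p c))%:R) ?rpred_nat // natrX.
have pl0 : p%:R ^+ logn p c != 0 :> rat by rewrite expf_neq0.
rewrite invfM; field.
by rewrite d0 pl0.
Qed.

Lemma ltn_logn_pred (c : nat) : (2 < c)%N -> (logn p c < c.-1)%N.
Proof.
case: c => [|[|c]] // c_gt0; rewrite [c.+2.-1]/= ltnNge.
apply/negP=> le_cl; have := dvdn_leq (ltn0Sn c.+1) (pfactor_dvdnn p c.+2).
have := leq_exp2l c.+1 (logn p c.+2) (prime_gt1 p_pr); rewrite le_cl => le_pp.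
have := leq_trans (_ : 2 ^ c.+1 <= p ^ c.+1)%N le_pp.
rewrite leq_exp2r ?prime_gt1 // expnS => /(_ isT).
have := ltn_expl c (isT : (1 < 2)%N); lia.
Qed.

(** * Bernoulli denominators and power sums modulo a prime *)

(** Faulhaber's formula at [n = p], with its top term [p * B_m] moved to the
    left and one factor [p] given to each remaining Bernoulli number. *)
Lemma powsum_sub_bernoulli (m : nat) :
  (powsum m p)%:R - p%:R * bernoulli m =
  \sum_(i < m) 'C(m, i)%:R * (p%:R * bernoulli i) *
    (p%:R ^+ (m - i) / (m - i).+1%:R).
Proof.
rewrite powsum_bernoulli big_ord_recr /= subnn binn divr1 expr1 mul1r.
rewrite [p%:R * _]mulrC addrK; apply: eq_bigr => i _; rewrite exprS; ring.
Qed.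

(** By strong induction: [p ^ j / (j + 1)] is integral at [p] because the
    valuation of [j + 1] is at most [j]. *)
Lemma pintegral_p_bernoulli (m : nat) : pintegral p (p%:R * bernoulli m).
Proof.
elim/ltn_ind: m => m IH.
rewrite -[_ * _](subKr (powsum m p)%:R) powsum_sub_bernoulli.
apply: pintegralB; first exact: pintegral_nat.
apply: pintegral_sum => i; apply: pintegralM.
  by apply: pintegralM; [exact: pintegral_nat|exact: IH].
by apply: pintegral_expr_div => //; rewrite -ltnS ltn_logl.
Qed.

(** This is [p * B_m = T m p] modulo [p].  Compared with the integrality of
    [p * B_m], one more factor [p] has to be found in each term of
    [powsum_sub_bernoulli].  With [j = m - i - 1], it is available in
    [p ^ (j + 1) / (j + 2)] as soon as [j > 0].  For [j = 0] the denominator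
    [2], an obstacle if [p = 2], is cancelled by the binomial coefficient
    ['C(m, m - 1) = m], which is even. *)
Lemma powsum_bernoulli_mod (m : nat) :
  ~~ odd m -> pintegral p ((powsum m p)%:R / p%:R - bernoulli m).
Proof.
move=> m_even.
have -> : (powsum m p)%:R / p%:R - bernoulli m =
    ((powsum m p)%:R - p%:R * bernoulli m) / p%:R :> rat by field.
rewrite powsum_sub_bernoulli mulr_suml; apply: pintegral_sum => i.
rewrite -(subnSK (ltn_ord i)) exprS.
set j := (m - i.+1)%N.
have -> : 'C(m, i)%:R * (p%:R * bernoulli i) * (p%:R * p%:R ^+ j / j.+2%:R) / p%:R
  = (p%:R * bernoulli i) * ('C(m, i)%:R * (p%:R ^+ j / j.+2%:R)) :> rat.
  by field; rewrite p_neq0 /= -(natrD _ 2 j) pnatr_eq0.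
apply: pintegralM (pintegral_p_bernoulli i) _.
have [j0|j_gt0] := posnP j; last first.
  apply: pintegralM (pintegral_nat _) _; apply: pintegral_expr_div => //.
  by rewrite -ltnS (@ltn_logn_pred j.+2).
have mi1 : (m - i = 1)%N by rewrite -(subnSK (ltn_ord i)) -/j j0.
rewrite j0 expr0 -(bin_sub (ltnW (ltn_ord i))) mi1 bin1.
rewrite -(even_halfK m_even) -muln2 natrM div1r mulfK ?pnatr_eq0 //.
exact: pintegral_nat.
Qed.

(** [T m p / p] and [B_m] differ by a number integral at [p], so one is
    integral at [p] iff the other is. *)
Lemma dvd_bernoulli_den (m : nat) :
  ~~ odd m -> (p %| bernoulli_den m)%N = ~~ (p %| powsum m p)%N.
Proof.
move=> /powsum_bernoulli_mod hm; apply/idP/idP; last first.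
  apply: contraR => /pintegral_denq hB; apply/pintegral_dvd.
  rewrite -[_ / _](subrK (bernoulli m)) -[X in _ + X]opprK.
  apply: pintegralB => //; rewrite -sub0r.
  by apply: pintegralB => //; apply: pintegral_nat 0.
apply: contraL => /pintegral_dvd hS; apply/pintegral_denq.
by rewrite -(subKr ((powsum m p)%:R / p%:R) (bernoulli m)); apply: pintegralB.
Qed.

End AtPrime.

(** * Divisibility of power sums *)

Section PowerSums.
Import GRing.Theory Num.Theory.

Lemma exprD_mod_sqr (R : comNzSemiRingType) (x y : R) (k : nat) :
  exists q, ((x + y) ^+ k = x ^+ k + k%:R * x ^+ k.-1 * y + q * y ^+ 2)%R.
Proof.
elim: k => [|k [q IH]].
  by exists 0%R; rewrite !expr0 !mul0r !addr0.
exists (q * (x + y) + k%:R * x ^+ k.-1)%R; rewrite exprSr IH -natr1.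
by case: k {IH} => [|k]; rewrite /= ?exprS; ring.
Qed.

Lemma expr_reflect_mod_sqr (R : comNzRingType) (x y : R) (k : nat) : odd k ->
  exists q, (x ^+ k + (y - x) ^+ k = k%:R * x ^+ k.-1 * y + q * y ^+ 2)%R.
Proof.
move=> k_odd; have [q Hq] := exprD_mod_sqr R (- x)%R y k; exists q.
have even_k : k.-1 = (2 * k./2)%N by rewrite mul2n odd_halfK.
have kE : k = k.-1.+1 by case: k k_odd {Hq even_k}.
have xk : ((- x) ^+ k = - x ^+ k)%R.
  by rewrite kE !exprS even_k !exprM sqrrN mulNr.
by rewrite addrC [(y - x)%R]addrC Hq xk even_k !exprM sqrrN; ring.
Qed.

(** The interval [0, c * n) is the union of the translates of [0, n) by
    [t * n], [t < c].  To first order the translation by [t * n] adds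
    [m * t * n * T (m - 1) n] to the sum, and the [t < c] add up to ['C(c, 2)]. *)
Lemma powsum_mul (m c n : nat) : exists q,
  powsum m (c * n) =
    c * powsum m n + m * 'C(c, 2) * n * powsum m.-1 n + q * n ^ 2.
Proof.
elim: c => [|c [q IH]].
  by exists 0; rewrite /powsum big_ord0 bin0n muln0 !mul0n.
have /(_ n)[r Hr] : forall l, exists r, \sum_(i < l) (c * n + i) ^ m =
    powsum m l + m * (c * n) * powsum m.-1 l + r * n ^ 2.
  elim=> [|l [r Hr]].
    by exists 0; rewrite /powsum !big_ord0 muln0.
  have [s Hs] := exprD_mod_sqr nat l (c * n) m; exists (r + s * c ^ 2).
  move: Hs; rewrite !natrXE natn => Hs.
  rewrite /powsum !big_ord_recr /= Hr [c * n + l]addnC.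
  rewrite -/(powsum m l) -/(powsum m.-1 l).
  rewrite Hs; ring.
exists (q + r); rewrite mulSn addnC /powsum big_split_ord /= -!/(powsum _ _).
rewrite Hr [powsum m (c * n)]IH binS bin1; ring.
Qed.

Lemma powsum_mul_mod (m c n : nat) : powsum m (c * n) = c * powsum m n %[mod n].
Proof.
have [q ->] := powsum_mul m c n.
rewrite (_ : _ + _ = (m * 'C(c, 2) * powsum m.-1 n + q * n) * n + c * powsum m n).
  by rewrite modnMDl.
ring.
Qed.

(** The terms other than [p * T m n] in [powsum_mul] are multiples of [p * n]:
    the linear one as [m] is even, so that [m * 'C(p, 2)] is a multiple of [p]
    even for [p = 2], the quadratic one as [p] divides [n]. *)
Lemma dvdn_powsum_mul (m p n : nat) : ~~ odd m -> prime p -> p %| n ->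
  (p * n %| powsum m (p * n)) = (n %| powsum m n).
Proof.
move=> m_even p_pr /dvdnP[d def_n].
have [q ->] := powsum_mul m p n.
have -> : m * 'C(p, 2) = m./2 * (p.-1 * p).
  rewrite -[in LHS](even_halfK m_even) -muln2 -mulnA [2 * _]mulnC.
  by rewrite (bin_ffact p 2) ffactnS ffactn1 [p * _]mulnC.
rewrite -addnA dvdn_addl ?dvdn_pmul2l ?prime_gt0 //.
apply/dvdnP; exists (m./2 * p.-1 * powsum m.-1 n + q * d).
have -> : n ^ 2 = d * p * n by rewrite -def_n mulnn.
ring.
Qed.

(** Write [n = p * l].  If [p] divides [l], then [n] and [l] have the same
    prime divisors and [dvdn_powsum_mul] applies.  Otherwise [p] and [l] are
    coprime, and cutting the interval both ways gives [T m n = l * T m p]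
    modulo [p] and [T m n = p * T m l] modulo [l]. *)
Lemma dvdn_powsum (m n : nat) : ~~ odd m -> 0 < n ->
  (n %| powsum m n) <-> (forall p, prime p -> p %| n -> p %| powsum m p).
Proof.
move=> m_even; elim/ltn_ind: n => n IH n_gt0.
have [-> | n_neq1] := eqVneq n 1.
  split=> [_ p p_pr|_]; last exact: dvd1n.
  by rewrite dvdn1 => /eqP p1; rewrite p1 in p_pr.
have n_gt1 : 1 < n by rewrite ltn_neqAle eq_sym n_neq1.
have p_pr := pdiv_prime n_gt1; move: (pdiv n) p_pr (pdiv_dvd n) => p p_pr.
case/dvdnP=> l; rewrite mulnC => def_n.
have l_gt0 : 0 < l by move: n_gt0; rewrite def_n muln_gt0 => /andP[].
have lt_ln : l < n by rewrite def_n ltn_Pmull ?prime_gt1.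
have {}IH := IH l lt_ln l_gt0; rewrite {n lt_ln n_gt0 n_gt1 n_neq1}def_n.
have [p_dv_l | pNl] := boolP (p %| l).
  rewrite dvdn_powsum_mul // IH; split=> H q q_pr q_dv; apply: H => //.
    by move: q_dv; rewrite Euclid_dvdM // => /orP[/dvdn_trans|]; first exact.
  exact: dvdn_mull.
have co_pl : coprime p l by rewrite prime_coprime.
have -> : (p * l %| powsum m (p * l)) = (p %| powsum m p) && (l %| powsum m l).
  rewrite Gauss_dvd // /dvdn (powsum_mul_mod m p l) mulnC powsum_mul_mod.
  by rewrite -!/(dvdn _ _) !Gauss_dvdr // coprime_sym.
split=> [/andP[p_dv /IH l_dv] q q_pr|H].
  rewrite Euclid_dvdM // => /orP[|]; last exact: l_dv.
  by rewrite dvdn_prime2 // => /eqP->.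
rewrite H ?dvdn_mulr //; apply/IH => q q_pr q_dv.
by rewrite H ?dvdn_mull.
Qed.

Lemma power_sum_powsum (k n : nat) : 0 < k -> power_sum k n = powsum k n.
Proof.
case: k n => [|k] [|n] // _; rewrite /power_sum /powsum.
  by rewrite big_geq ?big_ord0.
by rewrite big_add1 big_mkord big_ord_recl exp0n.
Qed.

(** Each [i ^ k + (n - i) ^ k] is [k * i ^ (k - 1) * n] modulo [n ^ 2].  Summing
    over [0 <= i < n] instead of [0 < i < n] adds [n ^ k] (from [i = 0]), a
    multiple of [n ^ 2] because [k > 1]; for [k = 1] the equivalence fails. *)
Lemma power_sum_double (k n : nat) : odd k -> 1 < k -> 0 < n ->
  (n ^ 2 %| 2 * power_sum k n) = (n %| k * powsum k.-1 n).
Proof.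
move=> k_odd k_gt1 n_gt0.
have k_gt0 := ltnW k_gt1.
have sumE : 2 * power_sum k n + n ^ k = \sum_(i < n) (i ^ k + (n - i) ^ k).
  rewrite big_split /= mul2n -addnn {1}power_sum_powsum // -addnA; congr (_ + _).
  case: n n_gt0 => // n _.
  rewrite power_sum_powsum // (reindex_inj rev_ord_inj) /=.
  rewrite [RHS](eq_bigr (fun i : 'I_n.+1 => i.+1 ^ k)); last first.
    by move=> i _; rewrite subKn.
  rewrite /powsum -(big_ord_recr n.+1 (fun i => i ^ k)) /=.
  by rewrite big_ord_recl /= exp0n.
(* In int, where the quotient q may be negative. *)
have /(_ n (leqnn n))[q Hq] : forall l, l <= n -> exists q : int,
    ((\sum_(i < l) (i ^ k + (n - i) ^ k))%:R =
      (n * (k * powsum k.-1 l))%:R + q * (n ^ 2)%:R)%R.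
  elim=> [|l IH] le_ln.
    by exists 0%R; rewrite /powsum !big_ord0 !muln0 mul0r.
  have [q Hq] := IH (ltnW le_ln).
  have [r Hr] := expr_reflect_mod_sqr int l%:R%R n%:R%R k k_odd.
  exists (q + r)%R; rewrite /powsum !big_ord_recr /= -/(powsum _ _).
  rewrite natrD Hq [X in (_ + X)%R]natrD !natrX natrB ?(ltnW le_ln) // Hr.
  rewrite !natrM natrD natrX; ring.
rewrite -(@dvdn_pmul2l n n) // mulnn.
have n2_nk : n ^ 2 %| n ^ k by rewrite dvdn_exp2l.
rewrite -(dvdn_addl _ n2_nk) sumE.
rewrite -[LHS]/((n ^ 2)%:Z %| (\sum_(i < n) (i ^ k + (n - i) ^ k))%:Z)%Z.
by rewrite -!natz Hq !natz rpredDr ?dvdz_mull.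
Qed.

End PowerSums.

Theorem corollary1p2 :
  (forall k n : nat, odd k -> k <> 1 -> 0 < n ->
     (forall p : nat, prime p -> p %| bernoulli_den k.-1 -> ~ (p %| n)) ->
     n ^ 2 %| 2 * power_sum k n) /\
  (forall k n : nat, odd k -> 0 < n -> coprime n k ->
     n ^ 2 %| 2 * power_sum k n ->
     forall p : nat, prime p -> p %| bernoulli_den k.-1 -> ~ (p %| n)).
Proof.
have even_pred k : odd k -> ~~ odd k.-1 by case: k.
split=> [k n k_odd k_neq1 n_gt0 hD|k n k_odd n_gt0 co_nk dv_n p p_pr pD p_dv_n].
  rewrite power_sum_double //; last by case: k k_odd k_neq1 {hD} => [|[|]].
  apply/dvdn_mull/dvdn_powsum; rewrite ?even_pred // => p p_pr p_dv_n.
  rewrite -[_ %| _]negbK -dvd_bernoulli_den ?even_pred //.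
  by apply/negP=> /hD; apply.
have k_gt1 : 1 < k.
  case: k k_odd pD {co_nk dv_n} => [|[|]] // _.
  by rewrite bernoulli_den0 dvdn1 => /eqP p1; rewrite p1 in p_pr.
move: dv_n pD; rewrite power_sum_double // Gauss_dvdr //.
rewrite dvd_bernoulli_den ?even_pred //.
by move/dvdn_powsum => /(_ (even_pred k k_odd) n_gt0 p p_pr p_dv_n) ->.
Qed.
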